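(* Let $(G,E,\varphi)$ be a self-similar triple and let $R$ be a unital commutative $*$-ring. Then there is a $*$-algebra $L_R(G,E)$ over $R$ generated by a $(G,E)$-family $\{p_{v,f},s_{e,g}\}$ with the following universal property: whenever $\{P_{v,f},S_{e,g}\}$ is a $(G,E)$-family in a $*$-algebra $A$ over $R$, there is a unique $*$-homomorphism $\pi_{G,E}\colon L_R(G,E)\to A$ such that $\pi_{G,E}(p_{v,f})=P_{v,f}$ and $\pi_{G,E}(s_{e,g})=S_{e,g}$ for all $v\in E^0$, $e\in E^1$ and $f,g\in G$.
   Context: A unital commutative $*$-ring $R$ is a commutative ring with $1$ together with an involution $r\mapsto r^*$. A $*$-algebra over $R$ is an (associative, not necessarily unital) $R$-algebra with a map $a\mapsto a^*$ satisfying $(a^* )^*=a$, $(ab)^*=b^*a^*$, $(ra+b)^*=r^*a^*+b^*$. A projection is $p=p^*=p^2$; a partial isometry is $s=ss^*s$. ''Generated'' means generated as a $*$-algebra over $R$. A directed graph $E=(E^0,E^1,r,s)$ has countable vertex set $E^0$, countable edge set $E^1$ and maps $r,s\colon E^1\to E^0$. It is row-finite if $vE^1:=r^{-1}(v)$ is finite for all $v$, and has no sources if $vE^1\neq\emptyset$ for all $v$. An action of a group $G$ on $E$ is a homomorphism from $G$ to the group of bijections of $E^0\sqcup E^1$ that preserve $E^0$ and $E^1$ and commute with $r$ and $s$. A self-similar triple $(G,E,\varphi)$: a countable discrete group $G$ (unit $e_G$), a row-finite graph $E$ with no sources, an action of $G$ on $E$, and a map $\varphi\colon G\times E^1\to G$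 with $\varphi(gh,e)=\varphi(g,h\cdot e)\varphi(h,e)$ and $\varphi(g,e)\cdot v=g\cdot v$ for all $g,h\in G$, $e\in E^1$, $v\in E^0$. An $E$-family in a $*$-algebra: mutually orthogonal projections $P_v$ ($v\in E^0$) and partial isometries $S_e$ ($e\in E^1$) with $S_e^*S_f=\delta_{e,f}P_{s(e)}$ and $P_v=\sum_{e\in vE^1}S_eS_e^*$. A $(G,E)$-family: elements $P_{v,f}$, $S_{e,g}$ ($v\in E^0$, $e\in E^1$, $f,g\in G$) such that (a) $\{P_{v,e_G}\}\cup\{S_{e,e_G}\}$ is an $E$-family; (b) $(P_{v,f})^*=P_{f^{-1}\cdot v,f^{-1}}$; (c) $P_{v,f}P_{w,h}=\delta_{v,f\cdot w}P_{v,fh}$; (d) $P_{v,f}S_{e,g}=\delta_{v,r(f\cdot e)}S_{f\cdot e,\varphi(f,e)g}$; (e) $S_{e,g}P_{v,f}=\delta_{g\cdot v,s(e)}S_{e,gf}$. *)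

(* Defs.v *)
From HB Require Import structures.
From mathcomp Require Import all_boot all_order all_algebra.
From mathcomp Require Import all_classical.

Set Implicit Arguments.
Unset Strict Implicit.
Unset Printing Implicit Defensive.
Import GRing.Theory.
Local Open Scope classical_set_scope.
Local Open Scope ring_scope.

(* The carrier may be the zero ring, so that [involutive_rmorphism] (which needs
   an [nzRingType]) is too narrow.  That [conjr 1 = 1] follows from the axioms. *)
HB.mixin Record hasConj R of GRing.ComPzRing R := {
  conjr : R -> R;
  conjrK : involutive conjr;
  conjrD : {morph conjr : x y / x + y};
  conjrM : {morph conjr : x y / x * y}
}.

#[short(type="comStarRingType")]
HB.structure Definition ComStarRing := { R of GRing.ComPzRing R & hasConj R }.

(* MathComp has no non-unital rings: the product of an algebra is the
   operation [amul] on the underlying left module. *)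
HB.mixin Record isStarAlgebra (R : comStarRingType) A of GRing.Lmodule R A := {
  amul : A -> A -> A;
  star : A -> A;
  amulA : associative amul;
  amulDl : left_distributive amul +%R;
  amulDr : right_distributive amul +%R;
  amulZl : forall (r : R) (x y : A), amul (r *: x) y = r *: amul x y;
  amulZr : forall (r : R) (x y : A), amul x (r *: y) = r *: amul x y;
  starK : involutive star;
  starM : forall x y : A, star (amul x y) = amul (star y) (star x);
  starZD : forall (r : R) (x y : A),
    star (r *: x + y) = conjr r *: star x + star y
}.

#[short(type="starAlgType")]
HB.structure Definition StarAlgebra (R : comStarRingType) :=
  { A of GRing.Lmodule R A & isStarAlgebra R A }.

Declare Scope star_algebra_scope.
Delimit Scope star_algebra_scope with SA.
Notation "x ** y" := (amul x y)
  (at level 40, left associativity) : star_algebra_scope.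
Notation "x ^*" := (star x) : star_algebra_scope.
Local Open Scope star_algebra_scope.

Section StarAlgebra.
Variable R : comStarRingType.

Definition projection (A : starAlgType R) (p : A) : Prop :=
  p = p^* /\ p = p ** p.

Definition partial_isometry (A : starAlgType R) (s : A) : Prop :=
  s = s ** s^* ** s.

Definition star_subalgebra (A : starAlgType R) (B : set A) : Prop :=
  [/\ B 0,
      forall (r : R) x y, B x -> B y -> B (r *: x + y),
      forall x y, B x -> B y -> B (x ** y)
    & forall x, B x -> B x^*].

Definition star_generates (A : starAlgType R) (X : set A) : Prop :=
  smallest (@star_subalgebra A) X = [set: A].

Definition star_morphism (A B : starAlgType R) (pi : A -> B) : Prop :=
  [/\ linear pi,
      forall x y, pi (x ** y) = pi x ** pi y
    & forall x, pi x^* = (pi x)^*].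

End StarAlgebra.

Record digraph := Digraph {
  vertex : choiceType;
  edge : choiceType;
  rng : edge -> vertex;
  src : edge -> vertex;
  countable_vertex : countable [set: vertex];
  countable_edge : countable [set: edge]
}.
Arguments rng {_} _.
Arguments src {_} _.

Definition edges_to (E : digraph) (v : vertex E) : set (edge E) :=
  [set e | rng e = v].

Definition row_finite (E : digraph) : Prop :=
  forall v : vertex E, finite_set (edges_to v).

Definition no_sources (E : digraph) : Prop :=
  forall v : vertex E, edges_to v !=set0.

(* A bijection of the disjoint union of vertices and edges that preserves both
   parts is given as a pair of bijections. *)
Definition graph_automorphism (E : digraph)
    (aV : vertex E -> vertex E) (aE : edge E -> edge E) : Prop :=
  [/\ bijective aV,
      bijective aE,
      forall e, rng (aE e) = aV (rng e)
    & forall e, src (aE e) = aV (src e)].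

Definition graph_action (G : groupType) (E : digraph)
    (actV : G -> vertex E -> vertex E) (actE : G -> edge E -> edge E) : Prop :=
  [/\ forall g, graph_automorphism (actV g) (actE g),
      forall g h v, actV (g * h)%g v = actV g (actV h v)
    & forall g h e, actE (g * h)%g e = actE g (actE h e)].

Definition self_similar_triple (G : groupType) (E : digraph)
    (actV : G -> vertex E -> vertex E) (actE : G -> edge E -> edge E)
    (phi : G -> edge E -> G) : Prop :=
  [/\ countable [set: G],
      row_finite E /\ no_sources E,
      graph_action actV actE,
      forall g h e, phi (g * h)%g e = (phi g (actE h e) * phi h e)%g
    & forall g e v, actV (phi g e) v = actV g v].

Section Families.
Variables (R : comStarRingType) (A : starAlgType R) (E : digraph).

(* [x *+ (i == j)] is the Kronecker delta of [i] and [j] times [x]. *)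
Definition graph_family (P : vertex E -> A) (S : edge E -> A) : Prop :=
  [/\ (forall v, projection (P v)) /\ (forall v w, v != w -> P v ** P w = 0),
      forall e, partial_isometry (S e),
      forall e f, (S e)^* ** S f = P (src e) *+ (e == f)
    & forall v, P v = \sum_(e \in edges_to v) S e ** (S e)^*].

Definition self_similar_family (G : groupType)
    (actV : G -> vertex E -> vertex E) (actE : G -> edge E -> edge E)
    (phi : G -> edge E -> G)
    (P : vertex E -> G -> A) (S : edge E -> G -> A) : Prop :=
  [/\ graph_family (fun v => P v 1%g) (fun e => S e 1%g),
      forall v f, (P v f)^* = P (actV f^-1%g v) f^-1%g,
      forall v w f h, P v f ** P w h = P v (f * h)%g *+ (v == actV f w),
      forall v e f g,
        P v f ** S e g = S (actE f e) (phi f e * g)%g *+ (v == rng (actE f e))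
    & forall v e f g, S e g ** P v f = S e (g * f)%g *+ (actV g v == src e)].

End Families.

(* Main.v *)
(** Quotient the formal *-algebra terms in the generators by the relation "equal
    under every evaluation at a family of the given kind".  Every identity that
    holds for all such families then holds in the quotient; in particular the
    *-algebra axioms and the defining relations of a (G,E)-family, which are all
    identities, hold there. *)

From HB Require Import structures.
Require Import Defs.
From mathcomp Require Import all_boot all_order all_algebra.
From mathcomp Require Import all_classical.

Set Implicit Arguments.
Unset Strict Implicit.
Unset Printing Implicit Defensive.

Local Open Scope classical_set_scope.

Import GRing.Theory.
Local Open Scope ring_scope.
Local Open Scope quotient_scope.
Local Open Scope star_algebra_scope.

(** * *-homomorphisms: sums, and determination by a generating set *)

Section StarMorphismTheory.
Context {R : comStarRingType} {A B : starAlgType R} {f : A -> B}.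
Hypothesis f_morph : star_morphism f.

Lemma star_morphismD (x y : A) : f (x + y) = f x + f y.
Proof. by case: f_morph => f_lin _ _; rewrite -[x in LHS]scale1r f_lin scale1r. Qed.

Lemma star_morphism0 : f 0 = 0.
Proof. by apply: (addrI (f 0)); rewrite -star_morphismD !addr0. Qed.

Lemma star_morphism_mulrn (x : A) n : f (x *+ n) = f x *+ n.
Proof.
by elim: n => [|n IHn]; rewrite ?mulr0n ?star_morphism0 // !mulrS star_morphismD IHn.
Qed.

(** Finiteness of [D] matters: a sum with infinite support is 0 by convention, and [f] could shrink
    an infinite support to a finite one. *)
Lemma star_morphism_fsum (I : choiceType) (D : set I) (F : I -> A) :
  finite_set D -> f (\sum_(i \in D) F i) = \sum_(i \in D) f (F i).
Proof.
by move=> finD; rewrite !fsbig_finite // (big_morph f star_morphismD star_morphism0).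
Qed.

End StarMorphismTheory.

(** The equalizer of [f] and [g] is a *-subalgebra containing [X], hence everything. This gives the
    uniqueness half of the universal property. *)
Lemma eq_star_morphism (R : comStarRingType) (A B : starAlgType R) (X : set A)
    (f g : A -> B) :
  star_generates X -> star_morphism f -> star_morphism g ->
  (forall x, X x -> f x = g x) -> f = g.
Proof.
move=> genX fM gM eqX; apply/funext => x.
have: [set: A] x by [].
rewrite -genX => /(_ [set y | f y = g y]); apply; split=> //.
case: (fM) (gM) => [fl fm fs] [gl gm gs]; split=> [|r y z /= ey ez|y z /= ey ez|y /= ey].
- by rewrite /= (star_morphism0 fM) (star_morphism0 gM).
- by rewrite fl gl ey ez.
- by rewrite fm gm ey ez.
- by rewrite fs gs ey.
Qed.

(** * Formal *-algebra terms and their quotient by a class of models *)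

Inductive star_term (R X : Type) : Type :=
  | TGen of X
  | TZero
  | TAdd of star_term R X & star_term R X
  | TScale of R & star_term R X
  | TMul of star_term R X & star_term R X
  | TStar of star_term R X.

(** The quotient relies on chosen representatives, so terms need a choice structure; it is taken
    classically because [R] and [X] are bare types. *)
HB.instance Definition _ (R X : Type) := gen_eqMixin (star_term R X).
HB.instance Definition _ (R X : Type) := gen_choiceMixin (star_term R X).

Section Presentation.
Variables (R : comStarRingType) (X : Type).
Variable models : forall A : starAlgType R, (X -> A) -> Prop.

Fixpoint eval {A : starAlgType R} (x : X -> A) (t : star_term R X) : A :=
  match t with
  | TGen i => x i
  | TZero => 0
  | TAdd t u => eval x t + eval x u
  | TScale r t => r *: eval x t
  | TMul t u => eval x t ** eval x u
  | TStar t => (eval x t)^*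
  end.

(** Since [Prop] is impredicative, quantifying over every [A] does not enlarge the quotient, which
    therefore lives among the same *-algebras. *)
Definition model_eq (t u : star_term R X) : bool :=
  `[< forall (A : starAlgType R) (x : X -> A), models x -> eval x t = eval x u >].

Lemma model_eq_equiv : equiv_class_of model_eq.
Proof.
split=> [t | t u | u t w /asboolP tu /asboolP uw].
- exact/asboolP.
- by apply/asboolP/asboolP => e A x xM; rewrite e.
- by apply/asboolP => A x xM; rewrite tu // uw.
Qed.

Canonical model_eq_equiv_rel := EquivRelPack model_eq_equiv.

Definition presented : Type := {eq_quot model_eq}.
HB.instance Definition _ := Choice.on presented.

Definition cls (t : star_term R X) : presented := \pi_({eq_quot model_eq}) t.
Definition rep (a : presented) : star_term R X := repr (a : {eq_quot model_eq}).

Definition ev {A : starAlgType R} (x : X -> A) (a : presented) : A := eval x (rep a).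

Lemma repK : cancel rep cls. Proof. exact: reprK. Qed.

(** The chosen representative of the class of [t] is related to [t], and related terms agree at
    every model. *)
Lemma ev_cls (A : starAlgType R) (x : X -> A) t : models x -> ev x (cls t) = eval x t.
Proof.
move=> xM; have /eqquotP/asboolP := repK (cls t); exact.
Qed.

(** Evaluations at models separate points by the very choice of relation. Every identity below is
    thereby checked in an honest *-algebra [A]. *)
Lemma presented_ext (a b : presented) :
  (forall (A : starAlgType R) (x : X -> A), models x -> ev x a = ev x b) -> a = b.
Proof.
by move=> eab; rewrite -[a]repK -[b]repK; apply/eqquotP/asboolP.
Qed.

Definition gen (i : X) : presented := cls (TGen R i).
Definition pzero : presented := cls (TZero R X).
(** Operations act on representatives and need no separate congruence proof: [ev_cls] shows that
    each evaluation at a model commutes with them. *)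
Definition padd (a b : presented) : presented := cls (TAdd (rep a) (rep b)).
Definition pscale (r : R) (a : presented) : presented := cls (TScale r (rep a)).
Definition popp (a : presented) : presented := pscale (-1) a.
Definition pmul (a b : presented) : presented := cls (TMul (rep a) (rep b)).
Definition pstar (a : presented) : presented := cls (TStar (rep a)).

Let evE (A : starAlgType R) (x : X -> A) (xM : models x) :=
  (fun i => ev_cls (TGen R i) xM : ev x (gen i) = x i,
   ev_cls (TZero R X) xM : ev x pzero = 0,
   fun a b => ev_cls (TAdd (rep a) (rep b)) xM
     : ev x (padd a b) = ev x a + ev x b,
   fun r a => ev_cls (TScale r (rep a)) xM : ev x (pscale r a) = r *: ev x a,
   fun a b => ev_cls (TMul (rep a) (rep b)) xM
     : ev x (pmul a b) = ev x a ** ev x b,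
   fun a => ev_cls (TStar (rep a)) xM : ev x (pstar a) = (ev x a)^*).

Let paddA : associative padd.
Proof. by move=> a b c; apply: presented_ext => A x xM; rewrite !(evE xM) addrA. Qed.
Let paddC : commutative padd.
Proof. by move=> a b; apply: presented_ext => A x xM; rewrite !(evE xM) addrC. Qed.
Let padd0 : left_id pzero padd.
Proof. by move=> a; apply: presented_ext => A x xM; rewrite !(evE xM) add0r. Qed.
Let paddN : left_inverse pzero popp padd.
Proof.
by move=> a; apply: presented_ext => A x xM; rewrite !(evE xM) scaleN1r addNr.
Qed.

HB.instance Definition _ := GRing.isZmodule.Build presented paddA paddC padd0 paddN.

Let pscaleA r s a : pscale r (pscale s a) = pscale (r * s) a.
Proof. by apply: presented_ext => A x xM; rewrite !(evE xM) scalerA. Qed.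
Let pscale1 : left_id 1 pscale.
Proof. by move=> a; apply: presented_ext => A x xM; rewrite !(evE xM) scale1r. Qed.
Let pscaleDr : right_distributive pscale +%R.
Proof. by move=> r a b; apply: presented_ext => A x xM; rewrite !(evE xM) scalerDr. Qed.
Let pscaleDl a : {morph pscale^~ a : r s / r + s}.
Proof. by move=> r s; apply: presented_ext => A x xM; rewrite !(evE xM) scalerDl. Qed.

HB.instance Definition _ :=
  GRing.Zmodule_isLmodule.Build R presented pscaleA pscale1 pscaleDr pscaleDl.

Let pmulA : associative pmul.
Proof. by move=> a b c; apply: presented_ext => A x xM; rewrite !(evE xM) amulA. Qed.
Let pmulDl : left_distributive pmul +%R.
Proof. by move=> a b c; apply: presented_ext => A x xM; rewrite !(evE xM) amulDl. Qed.
Let pmulDr : right_distributive pmul +%R.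
Proof. by move=> a b c; apply: presented_ext => A x xM; rewrite !(evE xM) amulDr. Qed.
Let pmulZl (r : R) (a b : presented) : pmul (r *: a) b = r *: pmul a b.
Proof. by apply: presented_ext => A x xM; rewrite !(evE xM) amulZl. Qed.
Let pmulZr (r : R) (a b : presented) : pmul a (r *: b) = r *: pmul a b.
Proof. by apply: presented_ext => A x xM; rewrite !(evE xM) amulZr. Qed.
Let pstarK : involutive pstar.
Proof. by move=> a; apply: presented_ext => A x xM; rewrite !(evE xM) starK. Qed.
Let pstarM a b : pstar (pmul a b) = pmul (pstar b) (pstar a).
Proof. by apply: presented_ext => A x xM; rewrite !(evE xM) starM. Qed.
Let pstarZD (r : R) (a b : presented) :
  pstar (r *: a + b) = conjr r *: pstar a + pstar b.
Proof. by apply: presented_ext => A x xM; rewrite !(evE xM) starZD. Qed.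

HB.instance Definition _ := isStarAlgebra.Build R presented
  pmulA pmulDl pmulDr pmulZl pmulZr pstarK pstarM pstarZD.

Lemma ev_gen (A : starAlgType R) (x : X -> A) i : models x -> ev x (gen i) = x i.
Proof. by move=> xM; rewrite (evE xM). Qed.

Lemma ev_star_morphism (A : starAlgType R) (x : X -> A) :
  models x -> star_morphism (ev x).
Proof. by move=> xM; split=> [r a b|a b|a]; rewrite !(evE xM). Qed.

(** For an arbitrary [models], [gen] need not itself be a model, so [ev_cls] cannot be used at
    [gen]; induction on the term replaces it. *)
Lemma eval_gen (t : star_term R X) : eval gen t = cls t.
Proof.
by elim: t => /= [i||t -> u ->|r t ->|t -> u ->|t ->];
  apply: presented_ext => A x xM; rewrite ?(evE xM) ?ev_cls.
Qed.

(** By [eval_gen] each element is a term evaluated at the generators, and such values stay in any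
    *-subalgebra containing them. *)
Lemma presented_generated : star_generates (range gen).
Proof.
apply/seteqP; split=> // a _ B [[B0 BZD BM Bstar] genB].
rewrite -[a]repK -eval_gen; elim: (rep a) => //= [i|t Bt u Bu|r t Bt|t Bt u Bu|t Bt].
- by apply: genB; exists i.
- by rewrite -[eval gen t]scale1r; apply: BZD.
- by rewrite -[r *: _]addr0; apply: BZD.
- exact: BM.
- exact: Bstar.
Qed.

End Presentation.

(** * Families of a self-similar triple as models *)

Section SelfSimilar.
Context {R : comStarRingType} {G : groupType} {E : digraph}.
Context {actV : G -> vertex E -> vertex E} {actE : G -> edge E -> edge E}.
Context {phi : G -> edge E -> G}.

(** The disjoint sum packs both kinds of generators into one index type, as the presentation
    expects. *)
Definition family_model (A : starAlgType R)
    (x : vertex E * G + edge E * G -> A) : Prop :=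
  self_similar_family actV actE phi
    (fun v f => x (inl (v, f))) (fun e g => x (inr (e, g))).

(** Each defining relation equates two *-algebra expressions in the generators and holds in all
    models, so [presented_ext] lifts it to the quotient. *)
Lemma presented_family :
  row_finite E -> family_model (gen family_model).
Proof.
move=> rfE; split; first split; first split.
- move=> v; split; apply: presented_ext => A x xM;
    have [_ eM eS] := ev_star_morphism xM; rewrite ?eS ?eM !ev_gen //;
    by case: xM => -[[/(_ v)[]]].
- move=> v w vw; apply: presented_ext => A x xM.
  have [_ eM _] := ev_star_morphism xM.
  rewrite eM !ev_gen // (star_morphism0 (ev_star_morphism xM)).
  by case: xM => -[[_ /(_ v w vw)]].
- move=> e; apply: presented_ext => A x xM; have [_ eM eS] := ev_star_morphism xM.
  by rewrite !eM eS !ev_gen //; case: xM => -[_ /(_ e)].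
- move=> e f; apply: presented_ext => A x xM; have [_ eM eS] := ev_star_morphism xM.
  rewrite eM eS (star_morphism_mulrn (ev_star_morphism xM)) !ev_gen //.
  by case: xM => -[_ _ /(_ e f)].
- move=> v; apply: presented_ext => A x xM; have [_ eM eS] := ev_star_morphism xM.
  (* Row-finiteness makes the range of summation finite, so evaluation passes through the sum. *)
  rewrite (star_morphism_fsum (ev_star_morphism xM)) // ev_gen //.
  case: (xM) => -[_ _ _ /(_ v) ->] _ _ _ _.
  by apply: eq_fsbigr => e _; rewrite eM eS !ev_gen.
- move=> v f; apply: presented_ext => A x xM; have [_ _ eS] := ev_star_morphism xM.
  by rewrite eS !ev_gen //; case: xM.
- move=> v w f h; apply: presented_ext => A x xM; have [_ eM _] := ev_star_morphism xM.
  by rewrite eM (star_morphism_mulrn (ev_star_morphism xM)) !ev_gen //; case: xM.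
- move=> v e f g; apply: presented_ext => A x xM; have [_ eM _] := ev_star_morphism xM.
  by rewrite eM (star_morphism_mulrn (ev_star_morphism xM)) !ev_gen //; case: xM.
- move=> v e f g; apply: presented_ext => A x xM; have [_ eM _] := ev_star_morphism xM.
  by rewrite eM (star_morphism_mulrn (ev_star_morphism xM)) !ev_gen //; case: xM.
Qed.

End SelfSimilar.

Unset Implicit Arguments.

Theorem theorem1p6 (R : comStarRingType) (G : groupType) (E : digraph)
    (actV : G -> vertex E -> vertex E) (actE : G -> edge E -> edge E)
    (phi : G -> edge E -> G)
    (GEphi : self_similar_triple actV actE phi) :
  exists (L : starAlgType R) (p : vertex E -> G -> L) (s : edge E -> G -> L),
    [/\ self_similar_family actV actE phi p s,
        star_generates
          ([set p v f | v in [set: vertex E] & f in [set: G]]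
           `|` [set s e g | e in [set: edge E] & g in [set: G]])
      & forall (A : starAlgType R)
          (P : vertex E -> G -> A) (S : edge E -> G -> A),
          self_similar_family actV actE phi P S ->
          exists! pi : L -> A,
            [/\ star_morphism pi,
                forall v f, pi (p v f) = P v f
              & forall e g, pi (s e g) = S e g]].
Proof.
pose M : forall A : starAlgType R, (vertex E * G + edge E * G -> A) -> Prop :=
  @family_model R G E actV actE phi.
pose p v f := gen M (inl (v, f)); pose s e g := gen M (inr (e, g)).
exists (presented M : starAlgType R), p, s.
have genL : star_generates
    ([set p v f | v in [set: vertex E] & f in [set: G]]
     `|` [set s e g | e in [set: edge E] & g in [set: G]]).
  have -> : [set p v f | v in [set: vertex E] & f in [set: G]]
      `|` [set s e g | e in [set: edge E] & g in [set: G]] = range (gen M).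
    apply/seteqP; split=> [a [[v _ [f _ <-]]|[e _ [g _ <-]]]|a [[[v f]|[e g]] _ <-]].
    - by exists (inl (v, f)).
    - by exists (inr (e, g)).
    - by left; exists v => //; exists f.
    - by right; exists e => //; exists g.
  exact: presented_generated.
split=> //; first by case: GEphi => _ [rfE _] _ _ _; apply: presented_family.
move=> A P S PS.
pose x (i : vertex E * G + edge E * G) : A :=
  match i with inl (v, f) => P v f | inr (e, g) => S e g end.
(* The two components of [x] reduce to [P] and [S], so this is the hypothesis [PS] up to
   computation. *)
have xM : M A x by [].
exists (ev x); split=> [|pi [piM piP piS]].
  by split=> [|v f|e g]; [exact: ev_star_morphism | exact: ev_gen | exact: ev_gen].
(* Uniqueness: it suffices that [pi] and [ev x] agree on the generators. *)
apply: (eq_star_morphism genL (ev_star_morphism xM) piM).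
by move=> a [[v _ [f _ <-]]|[e _ [g _ <-]]]; rewrite ?piP ?piS /p /s ev_gen.
Qed.
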